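(* There is an absolute constant $B>0$ such that for all integers $n\ge2$, $b\ge2$, $r\ge1$ with $c:=b^{2r}/n>1$ (i.e. $r=\frac12\log_b(nc)$), $$\|P^r_0-\pi\|_{TV}\le\frac{B}{\sqrt n}+\frac{B}{\sqrt c},$$ where $P^r_0$ is the distribution of the base-$b$ carries chain for adding $n$ numbers after $r$ steps started from $0$, and $\pi(j)=A(n,j)/n!$.
   Context: $A(n,j)$ is the number of permutations in $S_n$ with exactly $j$ descents. The base-$b$ carries chain for adding $n$ numbers is the Markov chain on $\{0,\dots,n-1\}$ given by $\kappa_0=0$, $\kappa_{t+1}=\lfloor(\kappa_t+X_{t+1,1}+\dots+X_{t+1,n})/b\rfloor$ with $X_{t,k}$ i.i.d. uniform on $\{0,\dots,b-1\}$. $\|P-Q\|_{TV}=\frac12\sum_x|P(x)-Q(x)|$. *)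

(* Defs.v *)
From mathcomp Require Import all_boot all_fingroup.
From Stdlib Require Import Reals.

Set Implicit Arguments.
Unset Strict Implicit.
Unset Printing Implicit Defensive.

Definition descents (n : nat) (s : {perm 'I_n}) : nat :=
  #|[set i : 'I_n | [exists k : 'I_n, (val k == (val i).+1) && (s k < s i)]]|.

Definition eulerian (n j : nat) : nat :=
  #|[set s : {perm 'I_n} | descents s == j]|.

(* One step of the base-b carries chain for adding n numbers:
   number of digit vectors (X_1,...,X_n) in {0,...,b-1}^n such that
   floor((i + X_1 + ... + X_n)/b) = j.  The transition probability is this
   count divided by b^n. *)
Definition carry_count (n b i j : nat) : nat :=
  #|[set x : {ffun 'I_n -> 'I_b} | (i + \sum_(k < n) (val (x k))) %/ b == j]|.

(* Number of digit arrays for r steps (weighted paths) leading from carry 0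
   to carry j; P^r_0(j) = carries_paths n b r j / b^(n r).
   The state space is {0,...,n-1}. *)
Fixpoint carries_paths (n b r j : nat) : nat :=
  match r with
  | 0 => if j == 0 then 1 else 0
  | r'.+1 => \sum_(i < n) carries_paths n b r' i * carry_count n b i j
  end.

Open Scope R_scope.

Definition carries_dist (n b r j : nat) : R :=
  INR (carries_paths n b r j) / INR (b ^ (n * r)).

Definition eulerian_dist (n j : nat) : R :=
  INR (eulerian n j) / INR (n `!).

Fixpoint rsum (m : nat) (f : nat -> R) : R :=
  match m with
  | 0 => 0
  | m'.+1 => rsum m' f + f m'
  end.

Definition tv_carries (n b r : nat) : R :=
  / 2 * rsum n (fun j => Rabs (carries_dist n b r j - eulerian_dist n j)).

(* Main.v *)
Require Import Defs.
From Stdlib Require Import Reals.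
From mathcomp Require Import all_boot all_order all_algebra all_fingroup.
From mathcomp Require Import zify ring lra.
From mathcomp Require Import Rstruct.

(** Write [N = b ^ r], [W] for a sum of [n] uniform digits in base [N], and
    [K_N(i, j)] for the probability that [(i + W) / N] has integer part [j].
    Splitting digits in base [M * N] gives [K_(MN)(0, .) = K_M(0, .) K_N], so
    that [P^r_0 = K_N(0, .)], and [K_(MN)(0, .)] is a mixture of the
    [K_N(i, .)] with [i < n].

    Taking partial sums modulo [L] turns digit vectors into words over [L]
    letters and carries into descents.  For large [L] most words have distinct
    letters, hence [K_L(0, .)] is close to the Eulerian distribution; here
    [L = n ^ 3 * N].

    It remains to compare [K_N(0, .)] with [K_N(i, .)], [i < n].  With
    [P = 1 + X + ... + X^(N-1)], this distance is at most [i] times the l1 norm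
    of [(1 - X) P^n], up to normalisation.  Splitting
    [P = (1 + ... + X^(h-1)) (1 + X^h) + (N mod 2) X^(2h)], [h = N / 2], and
    expanding reduces the norm to that of [(1 - X) (1 + X)^m], which telescopes
    to twice the central binomial coefficient and is thus
    [O(2^m / sqrt (m + 1))].  The outcome is [O(sqrt n / N) = O(1 / sqrt c)]. *)

Set Implicit Arguments.
Unset Strict Implicit.
Unset Printing Implicit Defensive.

Local Open Scope nat_scope.

(** * Composition of carries *)

Lemma carry_countE n b i j : carry_count n b i j =
  \sum_(x : {ffun 'I_n -> 'I_b}) ((i + \sum_(k < n) val (x k)) %/ b == j).
Proof. by rewrite /carry_count -sum1dep_card big_mkcond. Qed.

Lemma digit_sum_ltn n b (x : {ffun 'I_n -> 'I_b}) :
  0 < n -> \sum_(k < n) val (x k) < n * b.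
Proof.
case: n x => // n x _; rewrite big_ord_recl mulSn -addSn.
apply: leq_add; first exact: ltn_ord.
rewrite -[X in X * _]card_ord -sum_nat_const.
by apply: leq_sum => k _; apply: ltnW (ltn_ord _).
Qed.

Lemma pair_digit_ltn M N (u : 'I_M * 'I_N) : u.1 + M * u.2 < M * N.
Proof.
case: u => y z /=; apply: (@leq_trans (M * z.+1)).
  by rewrite mulnS ltn_add2r.
by rewrite leq_mul2l ltn_ord orbT.
Qed.

Definition pair_digit M N (u : 'I_M * 'I_N) : 'I_(M * N) :=
  Ordinal (pair_digit_ltn u).

Lemma pair_digit_bij M N : bijective (@pair_digit M N).
Proof.
apply: inj_card_bij; last by rewrite card_prod !card_ord.
move=> [y z] [y' z'] /(congr1 val) /= e.
have M0 : 0 < M by apply: leq_ltn_trans (ltn_ord y).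
have ey : y = y' :> nat.
  move/(congr1 (modn^~ M)): e; rewrite ![M * _]mulnC ![_ + _ * M]addnC.
  by rewrite !modnMDl !modn_small.
have ez : z = z' :> nat.
  by apply/eqP; rewrite -(eqn_pmul2l M0) -(eqn_add2l y) e ey.
by congr pair; apply: val_inj.
Qed.

(** Each digit in base [M * N] splits as [y + M * z]. The low parts send a carry [i < n] into the
    addition of the high parts in base [N], because floor division by [M * N] is division by [M]
    followed by division by [N]. *)
Lemma carry_count_mul n M N j : 0 < n -> 0 < M ->
  carry_count n (M * N) 0 j =
  \sum_(i < n) carry_count n M 0 i * carry_count n N i j.
Proof.
move=> n0 M0.
pose S b (x : {ffun 'I_n -> 'I_b}) := \sum_(k < n) val (x k).
pose join (u : {ffun 'I_n -> 'I_M} * {ffun 'I_n -> 'I_N}) :=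
  [ffun k => pair_digit (u.1 k, u.2 k)].
have joinB : bijective join.
  apply: inj_card_bij; last by rewrite card_prod !card_ffun !card_ord expnMn.
  move=> [y z] [y' z'] /ffunP e.
  have {}e k : (y k, z k) = (y' k, z' k).
    by apply: (bij_inj (@pair_digit_bij M N)); have := e k; rewrite !ffunE.
  by congr pair; apply/ffunP => k; case: (e k).
have SJ u : S _ (join u) = S _ u.1 + M * S _ u.2.
  rewrite /S big_distrr -big_split; apply: eq_bigr => k _.
  by rewrite ffunE.
transitivity (\sum_y \sum_z ((S M y %/ M + S N z) %/ N == j)).
  rewrite carry_countE (reindex join) /=; last exact: onW_bij.
  rewrite pair_big; apply: eq_bigr => u _.
  by rewrite add0n -/(S _ _) SJ divnMA mulnC addnC divnMDl // addnC.
have lt y : S M y %/ M < n by rewrite ltn_divLR // digit_sum_ltn.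
transitivity (\sum_y \sum_(i < n) (S M y %/ M == i) * carry_count n N i j).
  apply: eq_bigr => y _; rewrite (bigD1 (Ordinal (lt y))) //= eqxx mul1n.
  rewrite [X in _ + X]big1 ?addn0 ?carry_countE // => i.
  by rewrite -val_eqE /= eq_sym => /negbTE ->.
rewrite exchange_big; apply: eq_bigr => i _.
by rewrite -big_distrl [carry_count n M 0 i]carry_countE.
Qed.

Lemma carry_count_base1 n j : carry_count n 1 0 j = (j == 0).
Proof.
rewrite carry_countE (eq_bigr (fun=> nat_of_bool (j == 0))).
  by rewrite sum_nat_const card_ffun !card_ord exp1n mul1n.
by move=> x _; rewrite big1 => [|k _]; rewrite ?ord1 // eq_sym.
Qed.

(** Since [b ^ r.+1 = b ^ r * b], the first [r] steps act as one addition in base [b ^ r], and the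
    last step adds the high digits. *)
Lemma carries_paths_count n b r j : 0 < n -> 0 < b ->
  carries_paths n b r j = carry_count n (b ^ r) 0 j.
Proof.
move=> n0 b0; elim: r j => [|r IH] j /=.
  by rewrite carry_count_base1; case: eqP.
rewrite expnSr carry_count_mul ?expn_gt0 ?b0 //.
by apply: eq_bigr => i _; rewrite IH.
Qed.
Lemma sum_carry_count n b : 0 < n -> 0 < b ->
  \sum_(j < n) carry_count n b 0 j = b ^ n.
Proof.
move=> n0 b0; under eq_bigr do rewrite carry_countE.
rewrite exchange_big -[in RHS](card_ord b) -[n in RHS](card_ord n) -card_ffun.
rewrite -sum1_card; apply: eq_bigr => x _.
have lt : (0 + \sum_(k < n) val (x k)) %/ b < n.
  by rewrite ltn_divLR // digit_sum_ltn.
rewrite (bigD1 (Ordinal lt)) //= eqxx big1 // => i.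
by rewrite -val_eqE /= eq_sym => /negbTE ->.
Qed.

(** * Carries and descents *)

Lemma descentsE n (s : {perm 'I_n.+1}) :
  descents s = \sum_(i < n) (s (inord i.+1) < s (inord i)).
Proof.
rewrite /descents -sum1dep_card big_mkcond big_ord_recr /=.
(* The last index has no successor, hence contributes no descent. *)
case: existsP => [[k /andP[/eqP e _]]|_].
  by have := ltn_ord k; rewrite e ltnn.
rewrite addn0; apply: eq_bigr => i _.
have -> : widen_ord (leqnSn n) i = inord i.
  by apply: val_inj; rewrite /= inordK // ltnS ltnW.
have v0 : @inord n i = i :> nat by rewrite inordK // ltnS ltnW.
have v1 : @inord n i.+1 = i.+1 :> nat by rewrite inordK // ltnS.
case: existsP => [[k /andP[/eqP e lt]]|h].
  suff <- : k = inord i.+1 by rewrite lt.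
  by apply: val_inj; rewrite /= v1 e; congr S.
case: ltnP => // lt; case: h; exists (inord i.+1).
by rewrite lt andbT; apply/eqP; rewrite v1; congr S.
Qed.

(** The increment [z k - z (k - 1)] modulo [L], with [0] before the first letter. Subtracting from
    [L] keeps truncated subtraction exact for letters below [L]. *)
Definition word_digit (L : nat) (z : nat -> nat) (k : nat) : nat :=
  (z k + (L - (if k is k'.+1 then z k' else 0))) %% L.

(* Adding the increments of a word modulo L produces a carry exactly at its descents. *)
Lemma sum_word_digit L z k : (forall i, i <= k -> z i < L) ->
  \sum_(i < k.+1) word_digit L z i = z k + L * \sum_(i < k) (z i.+1 < z i).
Proof.
elim: k => [|k IH] zL.
  rewrite big_ord_recl !big_ord0 muln0 !addn0 /word_digit subn0 modnDr.
  by rewrite modn_small // zL.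
rewrite big_ord_recr IH => [|i ik]; last by apply: zL; apply: leqW.
rewrite [in RHS]big_ord_recr /= /word_digit.
have z1 := zL _ (leqnSn k); have z2 := zL _ (leqnn k.+1).
case: ltnP => h.
  by rewrite modn_small; lia.
have -> : z k.+1 + (L - z k) = z k.+1 - z k + L by lia.
by rewrite modnDr modn_small; lia.
Qed.

(** Partial sums of the increments, reduced modulo [L], give back the letters. *)
Lemma word_digit_inj L z z' n : (forall i, i <= n -> z i < L) ->
  (forall i, i <= n -> z' i < L) ->
  (forall i, i <= n -> word_digit L z i = word_digit L z' i) ->
  forall i, i <= n -> z i = z' i.
Proof.
move=> zL zL' e i lei.
have E : \sum_(j < i.+1) word_digit L z j = \sum_(j < i.+1) word_digit L z' j.
  by apply: eq_bigr => j _; apply: e; rewrite -ltnS (leq_trans (ltn_ord j)).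
rewrite !sum_word_digit in E; last 2 first.
- by move=> j ji; apply: zL' (leq_trans ji lei).
- by move=> j ji; apply: zL (leq_trans ji lei).
move: (congr1 (modn^~ L) E); rewrite ![_ + L * _]addnC ![L * _]mulnC !modnMDl.
by rewrite !modn_small ?zL ?zL'.
Qed.

(** * Words with distinct letters *)

Definition vals (L : nat) (S : {set 'I_L}) : seq nat := map val (enum S).

Lemma vals_sorted L (S : {set 'I_L}) : sorted ltn (vals S).
Proof.
apply: (subseq_sorted ltn_trans _ (iota_ltn_sorted 0 L)).
by rewrite -val_enum_ord map_subseq // enumT filter_subseq.
Qed.

Lemma size_vals L (S : {set 'I_L}) : size (vals S) = #|S|.
Proof. by rewrite size_map -cardE. Qed.

Lemma vals_lt L (S : {set 'I_L}) i : i < #|S| -> nth 0 (vals S) i < L.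
Proof.
by rewrite -size_vals => h; have /mapP[x _ ->] := mem_nth 0 h; apply: ltn_ord.


Qed.

Lemma ltn_nth_vals L (S : {set 'I_L}) i j : i < #|S| -> j < #|S| ->
  (nth 0 (vals S) i < nth 0 (vals S) j) = (i < j).
Proof.
rewrite -size_vals => iS jS.
have mono := sorted_ltn_nth ltn_trans 0 (vals_sorted S).
case: (ltngtP i j) => [/(mono _ _ iS jS)|/(mono _ _ jS iS)|->].
- by [].
- by move/ltnW; rewrite ltnNge => ->.
- by rewrite ltnn.
Qed.

Lemma vals_inj L : injective (@vals L).
Proof.
move=> S T /(inj_map val_inj) e; apply/setP => x.
by rewrite -mem_enum e mem_enum.
Qed.

(** A word with distinct letters is encoded by its set of letters and the rank [s k] of the letter
    at place [k]. The word determines the set, and then the ranks, since the increasing enumeration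
    has no repetition. *)
Lemma arrangement_inj L n (S T : {set 'I_L}) (s t : {perm 'I_n}) :
  #|S| = n -> #|T| = n ->
  (forall k, nth 0 (vals S) (s k) = nth 0 (vals T) (t k)) -> S = T /\ s = t.
Proof.
move=> cS cT e.
have sub (S' T' : {set 'I_L}) (s' t' : {perm 'I_n}) :
    #|S'| = n -> #|T'| = n ->
    (forall k, nth 0 (vals S') (s' k) = nth 0 (vals T') (t' k)) ->
    {subset vals S' <= vals T'}.
  move=> cS' cT' e' x xS.
  have lt : index x (vals S') < n by rewrite -cS' -size_vals index_mem.
  have := e' (s'^-1 (Ordinal lt))%g; rewrite permKV /= nth_index // => ->.
  by rewrite mem_nth // size_vals cT'.
have eST : S = T.
  apply: vals_inj; apply: (irr_sorted_eq ltn_trans ltnn) => [||x];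
    rewrite ?vals_sorted //.
  by apply/idP/idP; [apply: (sub S T s t) | apply: (sub T S t s)].
split=> //; subst T; apply/permP => k; apply/ord_inj/eqP.
have u := sorted_uniq ltn_trans ltnn (vals_sorted S).
by rewrite -(nth_uniq 0 _ _ u) ?size_vals ?cS ?e.
Qed.

(** A set of [n.+1] letters and a permutation with [j] descents form a word [z] with [j] descents.
    Its increments are a digit vector of sum [z n + L * j] with [z n < L], so the carry is [j].
    Distinct pairs give distinct vectors. *)
Lemma eulerian_le_carry_count n L j :
  'C(L, n.+1) * eulerian n.+1 j <= carry_count n.+1 L 0 j.
Proof.
case: L => [|L]; first by rewrite bin0n.
pose z (u : {set 'I_L.+1} * {perm 'I_n.+1}) (k : nat) :=
  nth 0 (vals u.1) (u.2 (inord k)).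
pose x u : {ffun 'I_n.+1 -> 'I_L.+1} :=
  [ffun k : 'I_n.+1 => inord (word_digit L.+1 (z u) k)].
have xE u (k : 'I_n.+1) : x u k = word_digit L.+1 (z u) k :> nat.
  by rewrite ffunE inordK // ltn_mod.
pose A := setX [set S : {set 'I_L.+1} | #|S| == n.+1]
               [set s : {perm 'I_n.+1} | descents s == j].
have <- : #|A| = 'C(L.+1, n.+1) * eulerian n.+1 j.
  by rewrite cardsX card_draws card_ord.
have zL u k : u \in A -> z u k < L.+1.
  case: u => S s; rewrite !inE /= => /andP[/eqP cS _].
  by apply: vals_lt; rewrite cS.
rewrite -(card_in_imset (f := x)); last first.
  move=> [S s] [T t] uA vA exy.
  have ez k : k <= n -> z (S, s) k = z (T, t) k.
    apply: (@word_digit_inj L.+1 _ _ n) => [i _|i _|i le]; try exact: zL.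
    by rewrite -[i](@inordK n i) // -!xE exy.
  move: uA vA; rewrite !inE /= => /andP[/eqP cS _] /andP[/eqP cT _].
  have [|-> ->//] := @arrangement_inj _ _ S T s t cS cT.
  by move=> k; have := ez k; rewrite /z /= inord_val; apply; rewrite -ltnS.
apply: subset_leq_card; apply/subsetP => _ /imsetP[u uA ->].
rewrite inE add0n (eq_bigr (fun k : 'I_n.+1 => word_digit L.+1 (z u) k));
  last by move=> k _; apply: xE.
rewrite sum_word_digit => [|i _]; last exact: zL.
rewrite addnC mulnC divnMDl // divn_small ?zL // addn0.
move: uA; case: u => S s; rewrite !inE /= => /andP[/eqP cS /eqP <-].
rewrite descentsE; apply/eqP/eq_bigr => i _; rewrite /z /=.
by rewrite ltn_nth_vals ?cS.
Qed.

(** * Distance to the Eulerian distribution *)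

Lemma sum_eulerian n : \sum_(j < n.+1) eulerian n.+1 j = n.+1`!.
Proof.
have lt (s : {perm 'I_n.+1}) : descents s < n.+1.
  rewrite descentsE ltnS -[X in _ <= X](card_ord n) -sum1_card.
  by apply: leq_sum => i _; apply: leq_b1.
rewrite -[n.+1 in RHS]card_ord -cardsT -card_perm /perm_on.
rewrite -sum1_card (partition_big (fun s => Ordinal (lt s)) predT) //=.
apply: eq_bigr => j _; rewrite /eulerian -sum1dep_card; apply: eq_bigl => s.
by rewrite (_ : s \in _ = true) //; apply/subsetP => x; rewrite in_setT.
Qed.

Lemma ffact_leq_expn L n : L ^_ n <= L ^ n.
Proof.
elim: n => [|n IH]; rewrite ?ffactn0 // ffactnSr expnSr.
by rewrite leq_mul // leq_subr.
Qed.

(** For [L > 0] this says that [n] uniform letters out of [L] fail to be distinct with probability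
    at most [n ^ 2 / L]; it is multiplied out so that the induction stays in [nat]. *)
Lemma expn_le_ffact L n : L ^ n.+1 <= L * L ^_ n + n ^ 2 * L ^ n.
Proof.
elim: n => [|n IH]; first by rewrite ffactn0 expn1 muln1 leq_addr.
(* Truncation at [0] does no harm here: [L <= (L - n) + n] always holds. *)
have h1 : L * L ^_ n <= L ^_ n.+1 + n * L ^_ n.
  rewrite ffactnSr [n * _]mulnC -mulnDr mulnC leq_mul2l; lia.
have h3 : n * L ^_ n <= n * L ^ n by rewrite leq_mul2l ffact_leq_expn orbT.
rewrite expnS (leq_trans (leq_mul (leqnn L) IH)) //.
rewrite [L ^ n.+1]expnS; move: (L ^ n) (L ^_ n) (L ^_ n.+1) h1 h3 => u v w h1 h3.
nia.
Qed.

Import Order.TTheory GRing.Theory Num.Theory.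
Local Open Scope ring_scope.

(** Write [p - q = (p - t q) - (1 - t) q]: both parts are nonnegative of total mass [1 - t]. *)
Lemma l1_dist_domination (R : realDomainType) n (p q : 'I_n -> R) (t : R) :
  t <= 1 -> (forall j, 0 <= q j) -> (forall j, t * q j <= p j) ->
  \sum_j p j = 1 -> \sum_j q j = 1 -> \sum_j `|p j - q j| <= 2 * (1 - t).
Proof.
move=> t1 q0 tqp sp sq.
have <- : \sum_j ((p j - t * q j) + (1 - t) * q j) = 2 * (1 - t).
  rewrite big_split /= sumrB -!mulr_sumr sp sq. by ring.
apply: ler_sum => j _.
have -> : p j - q j = (p j - t * q j) - (1 - t) * q j by ring.
apply: le_trans (ler_normB _ _) _.
by rewrite !ger0_norm ?mulr_ge0 ?subr_ge0.
Qed.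

(** With [t] the probability that [n.+1] uniform letters are distinct, the carry distribution
    dominates [t] times the Eulerian one. *)
Lemma carry_eulerian_dist (R : realFieldType) n L : (0 < L)%N ->
  \sum_(j < n.+1) `|(carry_count n.+1 L 0 j)%:R / (L ^ n.+1)%:R
                    - (eulerian n.+1 j)%:R / (n.+1`!)%:R|
  <= 2 * (n.+1 ^ 2)%:R / L%:R :> R.
Proof.
move=> L0.
have Lp m : 0 < (L ^ m)%:R :> R by rewrite ltr0n expn_gt0 L0.
have Fp : 0 < (n.+1`!)%:R :> R by rewrite ltr0n fact_gt0.
set t : R := (L ^_ n.+1)%:R / (L ^ n.+1)%:R.
have t1 : 1 - t <= (n.+1 ^ 2)%:R / L%:R.
  have := expn_le_ffact L n.+1.
  rewrite expnS -(ler_nat R) natrD (natrM _ L (L ^ _)) (natrM _ L (_ ^_ _)).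
  rewrite (natrM _ (_ ^ 2)) => h.
  have L0' : 0 < L%:R :> R by rewrite ltr0n.
  rewrite lerBlDr.
  have -> : (n.+1 ^ 2)%:R / L%:R + t =
     (L%:R * (L ^_ n.+1)%:R + (n.+1 ^ 2)%:R * (L ^ n.+1)%:R)
     / (L%:R * (L ^ n.+1)%:R) :> R.
    by rewrite /t; field; rewrite !lt0r_neq0.
  by rewrite ler_pdivlMr ?mulr_gt0 // mul1r.
apply: (@le_trans _ _ (2 * (1 - t))); last first.
  by rewrite -mulrA ler_pM2l.
apply: l1_dist_domination.
- by rewrite /t ler_pdivrMr // mul1r ler_nat ffact_leq_expn.
- by move=> j; rewrite divr_ge0.
- move=> j; rewrite /t mulrAC ler_pM2r ?invr_gt0 //.
  (* The falling factorial is the binomial times the factorial, and the latter cancels the Eulerian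
     normalisation. *)
  rewrite -bin_ffact natrM mulrA mulrAC mulfK ?lt0r_neq0 // -natrM ler_nat.
  exact: eulerian_le_carry_count.
- by rewrite -mulr_suml -natr_sum sum_carry_count // divff // lt0r_neq0.
- by rewrite -mulr_suml -natr_sum sum_eulerian divff // lt0r_neq0.
Qed.

(** * The l1 norm of polynomials *)

Definition l1 (R : numDomainType) (p : {poly R}) : R := \sum_(i < size p) `|p`_i|.

Lemma l1_widen (R : numDomainType) m (p : {poly R}) : (size p <= m)%N ->
  l1 p = \sum_(i < m) `|p`_i|.
Proof.
move=> le; rewrite /l1 (big_ord_widen _ (fun i => `|p`_i|) le) big_mkcond.
apply: eq_bigr => i _; case: ltnP => // h.
by rewrite nth_default // normr0.
Qed.

Lemma sum_norm_coef_le_l1 (R : numDomainType) m (p : {poly R}) :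
  \sum_(i < m) `|p`_i| <= l1 p.
Proof.
rewrite (l1_widen (leq_maxr m (size p))).
rewrite (big_ord_widen _ (fun i => `|p`_i|) (leq_maxl m (size p))) big_mkcond.
by apply: ler_sum => i _; case: ifP.
Qed.

Lemma l1_ge0 (R : numDomainType) (p : {poly R}) : 0 <= l1 p.
Proof. by apply: sumr_ge0. Qed.

Lemma l1D (R : numDomainType) (p q : {poly R}) : l1 (p + q) <= l1 p + l1 q.
Proof.
rewrite (l1_widen (size_polyD p q)) (l1_widen (leq_maxl (size p) (size q))).
rewrite (l1_widen (leq_maxr (size p) (size q))) -big_split /=.
by apply: ler_sum => i _; rewrite coefD ler_normD.
Qed.

Lemma l1_sum (R : numDomainType) I (r : seq I) (F : I -> {poly R}) :
  l1 (\sum_(i <- r) F i) <= \sum_(i <- r) l1 (F i).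
Proof.
elim/big_rec2: _ => [|i x p _ h]; first by rewrite /l1 size_poly0 big_ord0.
by apply: le_trans (l1D _ _) _; rewrite lerD2l.
Qed.

Lemma l1Z (R : numDomainType) (c : R) (p : {poly R}) : l1 (c *: p) = `|c| * l1 p.
Proof.
rewrite (l1_widen (size_scale_leq c p)) /l1 mulr_sumr.
by apply: eq_bigr => i _; rewrite coefZ normrM.
Qed.

Lemma l1Mn (R : numDomainType) (p : {poly R}) k : l1 (p *+ k) = l1 p *+ k.
Proof. by rewrite -scaler_nat l1Z normr_nat mulr_natl. Qed.

Lemma l1XnM (R : numDomainType) (p : {poly R}) k : l1 ('X^k * p) = l1 p.
Proof.
have le : (size ('X^k * p)%R <= k + size p)%N.
  by apply: leq_trans (size_polyMleq _ _) _; rewrite size_polyXn addSn.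
rewrite (l1_widen le) big_split_ord /= big1 ?add0r => [|i _].
  by apply: eq_bigr => i _; rewrite coefXnM ltnNge leq_addr /= addKn.
by rewrite coefXnM ltn_ord normr0.
Qed.

Lemma l1Xn (R : numDomainType) k : l1 ('X^k : {poly R}) = 1.
Proof.
by rewrite -['X^k]mulr1 l1XnM /l1 size_poly1 big_ord1 coef1 normr1.
Qed.

Lemma l1M (R : numDomainType) (p q : {poly R}) : l1 (p * q) <= l1 p * l1 q.
Proof.
rewrite -[p in p * q]coefK poly_def mulr_suml.
apply: le_trans (l1_sum _ _) _; rewrite [X in X * _]/l1 mulr_suml.
by apply: ler_sum => i _; rewrite -scalerAl l1Z l1XnM.
Qed.

Lemma l1_exp (R : numDomainType) (p : {poly R}) k : l1 (p ^+ k) <= l1 p ^+ k.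
Proof.
elim: k => [|k IH]; first by rewrite expr0 -(expr0 'X) l1Xn.
by rewrite !exprS; apply: le_trans (l1M _ _) _; rewrite ler_wpM2l ?l1_ge0.
Qed.

(** Substitution only spaces the coefficients out when [k > 0], but adds them all up when [k = 0];
    hence an inequality. *)
Lemma l1_comp_Xn (R : numDomainType) (p : {poly R}) k : l1 (p \Po 'X^k) <= l1 p.
Proof.
rewrite comp_polyE; apply: le_trans (l1_sum _ _) _.
by apply: ler_sum => i _; rewrite l1Z -exprM l1Xn mulr1.
Qed.

(** * Geometric polynomials *)

Definition geom (R : nzRingType) (N : nat) : {poly R} := \sum_(i < N) 'X^i.

Lemma geomM (R : nzRingType) N : (1 - 'X) * geom R N = 1 - 'X^N.
Proof. by rewrite -opprB mulNr /geom -subrX1 opprB. Qed.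

Lemma l1_geom (R : numDomainType) N : l1 (geom R N) <= N%:R.
Proof.
apply: le_trans (l1_sum _ _) _; under eq_bigr do rewrite l1Xn.
by rewrite sumr_const card_ord.
Qed.

(** Two consecutive blocks of length [N./2], and the top monomial when [N] is odd. *)
Lemma geom_decomp (R : nzRingType) N :
  geom R N = geom R N./2 * (1 + 'X^(N./2)) + 'X^(N./2 + N./2) *+ odd N.
Proof.
have split m k : geom R (m + k) = geom R m + 'X^m * geom R k.
  rewrite /geom big_split_ord mulr_sumr; congr (_ + _).
  by apply: eq_bigr => i _; rewrite exprD.
rewrite -[in LHS](odd_double_half N) addnC -addnn !split mulrDr mulr1.
rewrite [geom _ _ * 'X^_]commr_polyXn; congr (_ + _).
by case: (odd N); rewrite /geom ?big_ord1 ?big_ord0 ?mulr1 ?mulr0.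
Qed.

Lemma l1_sub1Xn (R : numDomainType) i (p : {poly R}) :
  l1 ((1 - 'X^i) * p) <= i%:R * l1 ((1 - 'X) * p).
Proof.
rewrite -geomM mulrAC mulrC; apply: le_trans (l1M _ _) _.
by rewrite ler_wpM2r ?l1_ge0 ?l1_geom.
Qed.

(** * Central binomial coefficients *)

Lemma coef_1DXn (R : nzRingType) m i : ((1 + 'X) ^+ m : {poly R})`_i = 'C(m, i)%:R.
Proof.
elim: m i => [|m IH] i; first by rewrite expr0 coef1 bin0n.
rewrite exprS mulrDl mul1r coefD coefXM IH.
by case: i => [|i]; rewrite ?bin0 ?addr0 //= IH binS natrD addrC.
Qed.

Lemma bin_incr m i : (i < m./2)%N -> ('C(m, i) <= 'C(m, i.+1))%N.
Proof.
move=> h; rewrite -(@leq_pmul2l i.+1) // mul_bin_left leq_mul2r; lia.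
Qed.

Lemma bin_decr m i : (m./2 <= i)%N -> ('C(m, i.+1) <= 'C(m, i))%N.
Proof.
move=> h; rewrite -(@leq_pmul2l i.+1) // mul_bin_left leq_mul2r; lia.
Qed.

(** The coefficients are differences of consecutive binomials, which rise up to [m./2] and then
    fall. With [C] the central binomial, the absolute values telescope to [1 + (C - 1) + C]. *)
Lemma l1_sub1X_binomial (R : numDomainType) m :
  l1 ((1 - 'X) * (1 + 'X) ^+ m : {poly R}) <= 2 * 'C(m, m./2)%:R.
Proof.
set p := _ * _.
have p0 : p`_0 = 1 by rewrite /p mulrBl mul1r coefB coefXM coef_1DXn bin0 subr0.
have pS i : p`_i.+1 = 'C(m, i.+1)%:R - 'C(m, i)%:R.
  by rewrite /p mulrBl mul1r coefB coefXM /= !coef_1DXn.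
have sp : (size p <= m.+2)%N.
  by apply/leq_sizeP => -[//|i] h; rewrite pS !bin_small ?subrr // ltnW.
rewrite (l1_widen sp) big_ord_recl p0 normr1.
under eq_bigr => i _ do rewrite /= pS.
rewrite -(big_mkord predT (fun i => `|'C(m, i.+1)%:R - 'C(m, i)%:R|)) /=.
have h : (m./2 <= m.+1)%N by lia.
rewrite (big_cat_nat (n := m./2)) //=.
rewrite (eq_big_nat _ _ (F2 := fun i => 'C(m, i.+1)%:R - 'C(m, i)%:R)); last first.
  by move=> i /andP[_ lt]; rewrite ger0_norm // subr_ge0 ler_nat bin_incr.
rewrite telescope_sumr // bin0.
rewrite (eq_big_nat _ _ (F2 := fun i => - ('C(m, i.+1)%:R - 'C(m, i)%:R))); last first.
  by move=> i /andP[le _]; rewrite ler0_norm // subr_le0 ler_nat bin_decr.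
rewrite sumrN telescope_sumr // (@bin_small m m.+1) //.
by rewrite le_eqVlt; apply/orP; left; apply/eqP; ring.
Qed.

Lemma central_binS k :
  ('C(k.+1.*2, k.+1) = 2 * 'C(k.*2.+1, k))%N /\
  ('C(k.*2.+1, k) = 'C(k.*2.+1, k.+1))%N.
Proof.
have e : ('C(k.*2.+1, k) = 'C(k.*2.+1, k.+1))%N.
  by rewrite -bin_sub; [congr 'C(_, _)|]; lia.
by split=> //; rewrite doubleS binS -e; lia.
Qed.

(** Consecutive central binomials have ratio [2 (2k + 1) / (k + 1)], so the induction step comes
    down to [(2k + 1) (2k + 3) <= 4 (k + 1)^2]. *)
Lemma central_bin_sqr_even k : ('C(k.*2, k) ^ 2 * k.*2.+1 <= 4 ^ k.*2)%N.
Proof.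
elim: k => [|k IH]; first by [].
have e : (k.+1 * 'C(k.+1.*2, k.+1) = 2 * k.*2.+1 * 'C(k.*2, k))%N.
  have [-> ->] := central_binS k.
  by rewrite -mulnA [in RHS](mul_bin_diag k.*2.+1) mulnCA.
rewrite -(@leq_pmul2l (k.+1 ^ 2)) ?expn_gt0 // mulnA -expnMn e.
rewrite doubleS 2!(expnS 4).
move: ('C(k.*2, k)) (4 ^ k.*2)%N IH => u v; rewrite -!mul2n => IH.
apply: (@leq_trans ((2 * k).+1 * (2 * k).+3 * 4 * v)); last first.
  have -> : (k.+1 ^ 2 * (4 * (4 * v)) = k.+1 ^ 2 * 4 * 4 * v)%N by lia.
  by rewrite !leq_mul2r; apply/orP; right; apply/orP; right; nia.
have -> : ((2 * (2 * k).+1 * u) ^ 2 * (2 * k).+3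
   = (2 * k).+1 * (2 * k).+3 * 4 * (u ^ 2 * (2 * k).+1))%N.
  by rewrite !expnS expn0; ring.
by rewrite leq_mul2l IH orbT.
Qed.

(** For [m = 2k + 1] the coefficient is half the central one of row [2k + 2]. *)
Lemma central_bin_sqr m : ('C(m, m./2) ^ 2 * m.+1 <= 4 ^ m)%N.
Proof.
rewrite -[m]odd_double_half; set k := m./2.
case: (odd m); last by rewrite add0n doubleK central_bin_sqr_even.
rewrite add1n /= uphalf_double.
have := central_bin_sqr_even k.+1; rewrite (central_binS k).1.
rewrite doubleS [in (4 ^ k.*2.+2)%N]expnS; nia.
Qed.

Lemma central_bin_le (R : rcfType) m :
  'C(m, m./2)%:R <= 2 ^+ m / Num.sqrt m.+1%:R :> R.
Proof.
have s0 : 0 < Num.sqrt m.+1%:R :> R by rewrite sqrtr_gt0 ltr0n.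
rewrite ler_pdivlMr // -(ler_pXn2r (n := 2)) ?nnegrE ?mulr_ge0 ?exprn_ge0 ?sqrtr_ge0 //.
rewrite exprMn sqr_sqrtr ?ler0n // -exprM mulnC exprM -!natrX -natrM ler_nat.
exact: central_bin_sqr.
Qed.

(** For [m > 0], one factor [geom R h] turns [1 - X] into [1 - X^h]. What remains is
    [geom R h ^+ (m - 1)] times [(1 - X) (1 + X)^m] taken at [X^h], and the factor [h] on the left
    restores [h ^ m]. For [m = 0] no such factor exists, whence the extra term. *)
Lemma l1_block (R : rcfType) h m : (0 < h)%N ->
  h%:R * l1 ((1 - 'X) * (geom R h * (1 + 'X^h)) ^+ m)
  <= 2 * ((2 * h)%:R ^+ m / Num.sqrt m.+1%:R) + (2 * h)%:R *+ (m == 0%N).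
Proof.
move=> h0; case: m => [|m].
  rewrite expr0 mulr1 mulr1n ler_wpDl ?mulr_ge0 ?invr_ge0 ?sqrtr_ge0 //.
  rewrite natrM mulrC ler_wpM2r //.
  have -> : (1 - 'X : {poly R}) = 'X^0 + (-1) *: 'X^1 by rewrite expr0 expr1 scaleN1r.
  apply: le_trans (l1D _ _) _.
  by rewrite l1Z !l1Xn normrN normr1 mulr1 -natr1.
rewrite addr0.
have -> : (1 - 'X) * (geom R h * (1 + 'X^h)) ^+ m.+1 =
    geom R h ^+ m * (((1 - 'X) * (1 + 'X) ^+ m.+1) \Po 'X^h).
  rewrite rmorphM rmorphXn rmorphB rmorphD rmorph1 /= comp_polyX.
  by rewrite -geomM exprMn (exprS (geom R h)); ring.
have le : l1 (geom R h ^+ m * (((1 - 'X) * (1 + 'X) ^+ m.+1) \Po 'X^h))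
    <= h%:R ^+ m * (2 * (2 ^+ m.+1 / Num.sqrt m.+2%:R)).
  apply: le_trans (l1M _ _) _; apply: ler_pM; rewrite ?l1_ge0 //.
    apply: le_trans (l1_exp _ _) _.
    by rewrite lerXn2r ?nnegrE ?l1_ge0 ?l1_geom.
  apply: le_trans (l1_comp_Xn _ _) _; apply: le_trans (l1_sub1X_binomial _ _) _.
  by rewrite ler_wpM2l // central_bin_le.
apply: le_trans (ler_wpM2l _ le) _ => //.
by rewrite natrM exprMn (exprS h%:R) le_eqVlt; apply/orP; left; apply/eqP; ring.
Qed.

(** Since [C(n, k) / (k + 1) = C(n + 1, k + 1) / (n + 1)], the sum is the expansion of
    [(e + x)^(n + 1)] without its first term, up to the factor [x (n + 1)]. *)
Lemma binomial_inv_mean (R : realFieldType) (x e : R) n : 0 < x -> 0 <= e ->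
  \sum_(k < n.+1) e ^+ (n - k) * x ^+ k *+ 'C(n, k) / k.+1%:R
  <= (e + x) ^+ n.+1 / (x * n.+1%:R).
Proof.
move=> x0 e0; rewrite ler_pdivlMr ?mulr_gt0 ?ltr0n // exprDn [leRHS]big_ord_recl.
apply: ler_wpDl; first by rewrite mulrn_wge0 // mulr_ge0 ?exprn_ge0 // ltW.
rewrite mulr_suml; apply: ler_sum => k _; rewrite lift0 subSS.
have k0 : k.+1%:R != 0 :> R by rewrite pnatr_eq0.
have e1 : n.+1%:R * 'C(n, k)%:R = k.+1%:R * 'C(n.+1, k.+1)%:R :> R.
  by rewrite -natrM -[RHS]natrM (mul_bin_diag n.+1 k).
rewrite -[_ *+ 'C(n, k)]mulr_natr -[_ *+ 'C(n.+1, _)]mulr_natr exprSr.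
rewrite le_eqVlt; apply/orP; left; apply/eqP.
transitivity (e ^+ (n - k) * x ^+ k * x * (n.+1%:R * 'C(n, k)%:R) / k.+1%:R).
  by ring.
by rewrite e1 [k.+1%:R * _]mulrC !mulrA mulfK // !mulrA.
Qed.

(** AM-GM reduces the inverse square roots to inverses. The condition [2 e <= x] gives
    [(e + x) / x <= 3 / 2], and the constant is [(3 / 2 + 1) / 2 = 5 / 4]. *)
Lemma binomial_invsqrt_mean (R : rcfType) (x e : R) n : 0 < x -> 0 <= e ->
  2 * e <= x ->
  \sum_(k < n.+1) e ^+ (n - k) * x ^+ k *+ 'C(n, k) / Num.sqrt k.+1%:R
  <= 5 / 4 * ((e + x) ^+ n / Num.sqrt n.+1%:R).
Proof.
move=> x0 e0 ex; set s := Num.sqrt n.+1%:R.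
have s0 : 0 < s by rewrite sqrtr_gt0 ltr0n.
have ss : s * s = n.+1%:R by rewrite -expr2 sqr_sqrtr.
(* AM-GM: [2 / sqrt (k + 1) <= s / (k + 1) + 1 / s] *)
have amgm k : (Num.sqrt k.+1%:R)^-1 <= 2^-1 * (s / k.+1%:R + s^-1).
  set a := Num.sqrt _; have a0 : 0 < a by rewrite sqrtr_gt0 ltr0n.
  have -> : k.+1%:R = a * a by rewrite -expr2 sqr_sqrtr.
  have : 0 <= (s / a - 1) ^+ 2 / s by rewrite divr_ge0 ?sqr_ge0 // ltW.
  have -> : (s / a - 1) ^+ 2 / s = s / (a * a) + s^-1 - 2 * a^-1.
    by field; rewrite !gt_eqF.
  lra.
pose w (k : 'I_n.+1) := e ^+ (n - k) * x ^+ k *+ 'C(n, k).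
have w0 k : 0 <= w k by rewrite mulrn_wge0 // mulr_ge0 ?exprn_ge0 // ltW.
apply: (@le_trans _ _ (\sum_k (2^-1 * s * (w k / k.+1%:R) + 2^-1 / s * w k))).
  apply: ler_sum => k _; apply: le_trans (ler_wpM2l (w0 k) (amgm k)) _.
  by rewrite le_eqVlt; apply/orP; left; apply/eqP; ring.
rewrite big_split -!mulr_sumr /= /w -exprDn.
have := binomial_inv_mean n x0 e0; rewrite -/w.
set S := \sum_k _ => hS.
have {hS} : S <= 3 / 2 * ((e + x) ^+ n / (s * s)).
  apply: le_trans hS _; rewrite exprS ss invfM.
  have -> : (e + x) * (e + x) ^+ n * (x^-1 * n.+1%:R^-1) =
     ((e + x) / x) * ((e + x) ^+ n / n.+1%:R) by ring.
  apply: ler_wpM2r; first by rewrite divr_ge0 // exprn_ge0 // addr_ge0 // ltW.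
  by rewrite ler_pdivrMr //; lra.
move=> /(ler_wpM2l (ltW s0)).
have -> : s * (3 / 2 * ((e + x) ^+ n / (s * s))) = 3 / 2 * ((e + x) ^+ n / s).
  by field; rewrite gt_eqF.
have -> : 2^-1 / s * (e + x) ^+ n = 2^-1 * ((e + x) ^+ n / s) by ring.
rewrite -mulrA; lra.
Qed.

Lemma sqrtS_le_exp2 (R : rcfType) n : Num.sqrt n.+1%:R <= 2 ^+ n :> R.
Proof.
rewrite -(ler_pXn2r (n := 2)) ?nnegrE ?exprn_ge0 ?sqrtr_ge0 //.
rewrite sqr_sqrtr // -exprM mulnC exprM -!natrX ler_nat.
by apply: ltn_expl.
Qed.

(** Expand the [n]-th power of [B + E], with [E] the odd monomial, and apply [l1_block] to each
    [B ^+ k]. With [u = N^n / sqrt (n + 1)], the main terms give [2 * 5/4 * u] and the extra term at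
    [k = 0] at most [2 u]. Then [N <= 3 h] yields [27/2 <= 14]. *)
Lemma l1_sub1X_geom (R : rcfType) N n : (1 < N)%N -> (0 < n)%N ->
  N%:R * l1 ((1 - 'X) * geom R N ^+ n) <= 14 * (N%:R ^+ n / Num.sqrt n.+1%:R).
Proof.
move=> N1 n0; set h := N./2; set o := odd N.
have h0 : (0 < h)%N by rewrite /h; lia.
have eN : (N = o + 2 * h)%N by rewrite /h /o; lia.
pose B := geom R h * (1 + 'X^h); pose E := 'X^(h + h) *+ o : {poly R}.
have lE j : l1 (E ^+ j) <= o%:R ^+ j.
  apply: le_trans (l1_exp _ _) _.
  by rewrite lerXn2r ?nnegrE ?l1_ge0 // l1Mn l1Xn.
have hh : 0 <= h%:R :> R by [].
have le1 : h%:R * l1 ((1 - 'X) * geom R N ^+ n) <=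
  \sum_(k < n.+1) (2 * (o%:R ^+ (n - k) * (2 * h)%:R ^+ k *+ 'C(n, k) / Num.sqrt k.+1%:R)
     + o%:R ^+ (n - k) * (2 * h)%:R *+ 'C(n, k) *+ (k == 0 :> nat)).
  rewrite geom_decomp -/h -/o [geom R h * _ + _]addrC exprDn [(1 - _) * _]mulr_sumr.
  apply: le_trans (ler_wpM2l hh (l1_sum _ _)) _; rewrite mulr_sumr.
  apply: ler_sum => k _; rewrite -/E -/B [(1 - _) * _]mulrnAr l1Mn.
  rewrite [(1 - _) * _]mulrCA.
  apply: (@le_trans _ _ (o%:R ^+ (n - k) * (h%:R * l1 ((1 - 'X) * B ^+ k)) *+ 'C(n, k))).
    rewrite [leLHS]mulrnAr lerMn2r; apply/orP; right.
    rewrite [leRHS]mulrCA ler_wpM2l //; apply: le_trans (l1M _ _) _.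
    by rewrite ler_wpM2r ?l1_ge0.
  have := @l1_block R h k h0; rewrite -/B => lb.
  have o0 : 0 <= o%:R ^+ (n - k) :> R by rewrite exprn_ge0.
  have := ler_wpM2l o0 lb; move/(ler_wMn2r 'C(n, k)) => lb'.
  apply: le_trans lb' _; rewrite le_eqVlt; apply/orP; left; apply/eqP.
  have pull (a x y : R) c : a * (2 * (x / y)) *+ c = 2 * (a * x *+ c / y).
    by rewrite -[_ * (2 * _) *+ c]mulr_natr -[a * x *+ c]mulr_natr; ring.
  rewrite mulrDr mulrnDl pull; congr (_ + _).
  by case: (_ == _); rewrite ?mulr1n ?mulr0n ?mulr0 ?mul0rn.
rewrite big_split /= -mulr_sumr in le1.
have le2 : \sum_(k < n.+1) o%:R ^+ (n - k) * (2 * h)%:R *+ 'C(n, k) *+ (k == 0 :> nat)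
     <= N%:R :> R.
  rewrite big_ord_recl big1 ?addr0 ?bin0 ?mulr1n => [|k _]; last by rewrite mulr0n.
  apply: (@le_trans _ _ (2 * h)%:R); last by rewrite ler_nat eN leq_addl.
  by rewrite ler_piMl // exprn_ile1 // lern1 leq_b1.
have x0 : 0 < (2 * h)%:R :> R by rewrite ltr0n muln_gt0.
have e0 : 0 <= o%:R :> R by [].
have ex : 2 * o%:R <= (2 * h)%:R :> R.
  by rewrite -natrM ler_nat; rewrite /o; case: (odd N) => /=; lia.
have le3 := binomial_invsqrt_mean n x0 e0 ex.
rewrite -natrD -eN in le3.
have s0 : 0 < Num.sqrt n.+1%:R :> R by rewrite sqrtr_gt0 ltr0n.
(* After cancelling [N] this is [sqrt (n + 1) <= 2 N^(n - 1)], which follows from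
   [sqrt (n + 1) <= 2^n] and [N >= 2]. *)
have le4 : N%:R <= 2 * (N%:R ^+ n / Num.sqrt n.+1%:R) :> R.
  rewrite mulrA ler_pdivlMr //; case: n n0 {le1 le2 le3 s0} => // n _.
  rewrite exprS mulrCA ler_wpM2l //; apply: le_trans (sqrtS_le_exp2 R n.+1) _.
  rewrite exprS ler_wpM2l // lerXn2r ?nnegrE // ler_nat //.
have N3 : N%:R <= 3 * h%:R :> R.
  by rewrite -natrM ler_nat /h; move: N1; clear; lia.
have u0 := divr_ge0 (exprn_ge0 n (ler0n R N)) (ltW s0).
apply: le_trans (ler_wpM2r (l1_ge0 _) N3) _; rewrite -mulrA.
have {}le2 := le_trans le2 le4.
move: le1 le2 le3 u0; move: (h%:R * _) (\sum_k _) (\sum_k _) (_ / _) => a b c u.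
lra.
Qed.

(** * Total variation of the carries chain *)

Lemma sum_block_coef_Xn (R : nzRingType) N j s : (0 < N)%N ->
  \sum_(k < N) ('X^s : {poly R})`_(j * N + k) = (s %/ N == j)%N%:R.
Proof.
move=> N0; case: eqP => [<-|ne].
  rewrite (bigD1 (Ordinal (ltn_pmod s N0))) //= coefXn -divn_eq eqxx big1 ?addr0 //.
  move=> k; rewrite -val_eqE /= => ne; rewrite coefXn {2}(divn_eq s N) eqn_add2l.
  by rewrite (negbTE ne).
rewrite big1 // => k _; rewrite coefXn; case: eqP => // e; case: ne.
by rewrite -e divnMDl // divn_small ?addn0.
Qed.

(** The polynomial is the generating function of [i] plus the digit sum; the [j]-th block of [N]
    coefficients collects the values with quotient [j]. *)
Lemma carry_count_coef (R : comNzRingType) n N i j : (0 < N)%N ->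
  (carry_count n N i j)%:R
  = \sum_(k < N) ('X^i * geom R N ^+ n)`_(j * N + k).
Proof.
move=> N0.
have -> : 'X^i * geom R N ^+ n =
    \sum_(x : {ffun 'I_n -> 'I_N}) 'X^(i + \sum_(k < n) val (x k)).
  have -> : geom R N ^+ n = \prod_(k < n) geom R N by rewrite prodr_const card_ord.
  rewrite /geom bigA_distr_bigA mulr_sumr.
  by apply: eq_bigr => x _; rewrite prodrXr -exprD.
under eq_bigr do rewrite coef_sum.
rewrite exchange_big carry_countE natr_sum; apply: eq_bigr => x _.
by rewrite sum_block_coef_Xn.
Qed.

Lemma sum_blocks (V : nmodType) n N (F : nat -> V) :
  \sum_(j < n) \sum_(k < N) F (j * N + k)%N = \sum_(t < n * N) F t.
Proof.
elim: n => [|n IH]; first by rewrite mul0n !big_ord0.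
rewrite big_ord_recr IH mulSn addnC big_split_ord; congr (_ + _).
Qed.

(** The differences are block sums of coefficients of [(1 - X^i) P^n]. *)
Lemma carry_count_shift (R : realDomainType) n N i : (0 < N)%N ->
  \sum_(j < n) `|(carry_count n N 0 j)%:R - (carry_count n N i j)%:R|
  <= i%:R * l1 ((1 - 'X) * geom R N ^+ n).
Proof.
move=> N0; apply: le_trans (l1_sub1Xn _ _).
set p := _ * _; apply: le_trans (sum_norm_coef_le_l1 (n * N) p).
rewrite -(sum_blocks n N (fun t => `|p`_t|)); apply: ler_sum => j _.
rewrite !(carry_count_coef R) // -sumrB; apply: le_trans (ler_norm_sum _ _ _) _.
by apply: ler_sum => k _; rewrite -coefB -mulrBl expr0.
Qed.

(** Average over the carry [i] out of the low digits, with weights [w i]. Bounding [i] by [n], the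
    norm estimate gives [14 n / (N sqrt n)]. *)
Lemma carry_count_refine (R : rcfType) n N M : (0 < n)%N -> (1 < N)%N -> (0 < M)%N ->
  \sum_(j < n) `|(carry_count n N 0 j)%:R / (N ^ n)%:R
                 - (carry_count n (M * N) 0 j)%:R / ((M * N) ^ n)%:R|
  <= 14 * (Num.sqrt n%:R / N%:R) :> R.
Proof.
move=> n0 N1 M0; have N0 : (0 < N)%N by apply: ltnW.
have Np m : 0 < (N ^ m)%:R :> R by rewrite ltr0n expn_gt0 N0.
have Mp m : 0 < (M ^ m)%:R :> R by rewrite ltr0n expn_gt0 M0.
set v := l1 ((1 - 'X) * geom R N ^+ n).
pose w (i : 'I_n) : R := (carry_count n M 0 i)%:R / (M ^ n)%:R.
have w0 i : 0 <= w i by rewrite divr_ge0.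
have w1 : \sum_i w i = 1.
  by rewrite -mulr_suml -natr_sum sum_carry_count // divff // gt_eqF.
have e (j : 'I_n) : (carry_count n N 0 j)%:R / (N ^ n)%:R
    - (carry_count n (M * N) 0 j)%:R / ((M * N) ^ n)%:R
  = \sum_i w i / (N ^ n)%:R * ((carry_count n N 0 j)%:R - (carry_count n N i j)%:R) :> R.
  under eq_bigr do rewrite mulrBr.
  rewrite sumrB -2!mulr_suml w1 mul1r mulrC; congr (_ - _).
  rewrite carry_count_mul // natr_sum mulr_suml; apply: eq_bigr => i _.
  by rewrite /w expnMn !natrM; field; rewrite !gt_eqF.
under eq_bigr => j _ do rewrite e.
apply: (@le_trans _ _ (\sum_(j < n) \sum_(i < n) w i / (N ^ n)%:R *
    `|(carry_count n N 0 j)%:R - (carry_count n N i j)%:R|)).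
  apply: ler_sum => j _; apply: le_trans (ler_norm_sum _ _ _) _.
  by apply: ler_sum => i _; rewrite normrM ger0_norm // divr_ge0.
rewrite exchange_big.
apply: (@le_trans _ _ (\sum_(i < n) w i * (n%:R * v / (N ^ n)%:R))).
  apply: ler_sum => i _; rewrite -mulr_sumr -mulrA ler_wpM2l //.
  rewrite mulrC ler_pM2r ?invr_gt0 //; apply: le_trans (carry_count_shift R n i N0) _.
  by rewrite ler_wpM2r ?l1_ge0 // ler_nat ltnW.
rewrite -mulr_suml w1 mul1r.
have N0' : 0 < N%:R :> R by rewrite ltr0n.
have s0 : 0 < Num.sqrt n%:R :> R by rewrite sqrtr_gt0 ltr0n.
have ss : Num.sqrt n%:R * Num.sqrt n%:R = n%:R :> R by rewrite -expr2 sqr_sqrtr.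
have h : N%:R * v <= 14 * ((N ^ n)%:R / Num.sqrt n%:R).
  apply: le_trans (l1_sub1X_geom R N1 n0) _; rewrite natrX ler_wpM2l //.
  rewrite ler_wpM2l ?exprn_ge0 // lef_pV2 ?posrE ?sqrtr_gt0 ?ltr0n //.
  by rewrite ler_sqrt ?ler_nat.
rewrite ler_pdivrMr // -(ler_pM2r N0') -[leLHS]mulrA [v * _]mulrC.
have -> : 14 * (Num.sqrt n%:R / N%:R) * (N ^ n)%:R * N%:R
  = Num.sqrt n%:R * Num.sqrt n%:R * (14 * ((N ^ n)%:R / Num.sqrt n%:R)) :> R.
  by field; rewrite !gt_eqF.
by rewrite ss ler_wpM2l.
Qed.

Lemma carry_eulerian_tv (R : rcfType) n N : (0 < n)%N -> (1 < N)%N ->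
  \sum_(j < n) `|(carry_count n N 0 j)%:R / (N ^ n)%:R
                 - (eulerian n j)%:R / n`!%:R|
  <= 14 * (Num.sqrt n%:R / N%:R) + 2 / Num.sqrt n%:R :> R.
Proof.
(* With this [M] the Eulerian error [2 n^2 / (M N)] is [2 / (n N)], below [2 / sqrt n]. *)
move=> n0 N1; pose M := (n ^ 3)%N.
have M0 : (0 < M)%N by rewrite expn_gt0 n0.
have L0 : (0 < M * N)%N by rewrite muln_gt0 M0 ltnW.
pose c (L j : nat) : R := (carry_count n L 0 j)%:R / (L ^ n)%:R.
apply: (@le_trans _ _ (\sum_(j < n) (`|c N j - c (M * N)%N j|
    + `|c (M * N)%N j - (eulerian n j)%:R / n`!%:R|))).
  by apply: ler_sum => j _; apply: ler_distD.
rewrite big_split /=; apply: lerD; first exact: carry_count_refine.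
apply: (@le_trans _ _ (2 * (n ^ 2)%:R / (M * N)%:R)).
  by case: n n0 @M M0 L0 @c => // n _ M M0 L0 c; apply: carry_eulerian_dist.
have s0 : 0 < Num.sqrt n%:R :> R by rewrite sqrtr_gt0 ltr0n.
rewrite -mulrA ler_wpM2l // ler_pdivrMr ?ltr0n // mulrC ler_pdivlMr //.
apply: (@le_trans _ _ ((n ^ 2)%:R * n%:R)).
  rewrite ler_wpM2l // -[leRHS]sqr_sqrtr // ler_eXnr //.
  by rewrite -[leLHS]sqrtr1 ler_sqrt ?ler1n.
by rewrite -natrM ler_nat /M -expnSr leq_pmulr // ltnW.
Qed.

(** * Transfer to the real numbers of the statement *)

Lemma rsumE (m : nat) (f : nat -> R) : rsum m f = \sum_(i < m) f i.
Proof. by elim: m => [|m IH] /=; rewrite ?big_ord0 // big_ord_recr -IH. Qed.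

Lemma Nat_powE (b m : nat) : Nat.pow b m = (b ^ m)%N.
Proof. by elim: m => //= m ->; rewrite expnS. Qed.

Lemma tv_carries_le (n b r : nat) : (0 < n)%N -> (1 < b ^ r)%N ->
  tv_carries n b r <= 7 * (Num.sqrt n%:R / (b ^ r)%:R) + (Num.sqrt n%:R)^-1.
Proof.
move=> n0 N1.
have b0 : (0 < b)%N by case: b N1 => //; case: r => [|r]; rewrite ?expn0 ?exp0n.
rewrite /tv_carries rsumE.
have := carry_eulerian_tv R n0 N1.
rewrite (eq_bigr (fun j : 'I_n => Rabs (carries_dist n b r j - eulerian_dist n j)%R)).
  set s := \sum_(j < n) _; set x := _ / (b ^ r)%:R; set y := (Num.sqrt _)^-1 => h.
  rewrite RmultE RinvE IZRposE INRE /=; lra.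
move=> j _; rewrite RabsE /carries_dist /eulerian_dist !RdivE !INRE.
by rewrite carries_paths_count // Nat_powE (mulnC n r) expnM.
Qed.

Lemma sqrt_sqr_pow_div (n b r : nat) :
  sqrt (Rdiv (INR (Nat.pow b (2 * r))) (INR n)) = (b ^ r)%:R / Num.sqrt n%:R.
Proof.
rewrite RsqrtE RdivE !INRE Nat_powE mulnC expnM natrX sqrtrM ?sqr_ge0 //.
by rewrite sqrtr_sqr ger0_norm // sqrtrV.
Qed.

(** The term [7 sqrt n / b^r] equals [7 / sqrt c]; the term [1 / sqrt n] is raised to [7 / sqrt n]
    so that one constant serves both. *)
Lemma tv_carries_sqrt_le (n b r : nat) : (1 < n)%N -> (1 < b)%N -> (0 < r)%N ->
  Rle (tv_carries n b r)
    (Rplus (Rdiv (7%:R : R) (sqrt (INR n)))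
           (Rdiv (7%:R : R) (sqrt (Rdiv (INR (Nat.pow b (2 * r))) (INR n))))).
Proof.
move=> n1 b1 r0; apply/RleP.
have N1 : (1 < b ^ r)%N by rewrite (leq_trans b1) // -[leqLHS]expn1 leq_exp2l.
rewrite sqrt_sqr_pow_div RplusE !RdivE RsqrtE INRE invf_div.
apply: le_trans (tv_carries_le (ltnW n1) N1) _; rewrite addrC lerD2r.
by rewrite ler_peMl ?invr_ge0 ?sqrtr_ge0 // ler1n.
Qed.

(* Imported again so that [^] on [nat] is [Nat.pow], as in [carries_dist]. *)
From Stdlib Require Import Reals.
Open Scope R_scope.

Theorem theorem3p4 :
  exists B : R, 0 < B /\
    forall n b r : nat, (2 <= n)%nat -> (2 <= b)%nat -> (1 <= r)%nat ->
      let c := INR (b ^ (2 * r)) / INR n in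
      1 < c ->
      tv_carries n b r <= B / sqrt (INR n) + B / sqrt c.
Proof.
exists 7%:R%R; split; first by apply/RltP; rewrite ltr0n.
by move=> n b r n1 b1 r0 c _; apply: tv_carries_sqrt_le.
Qed.
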